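(* Consider the $4\times 4$ symmetric matrices $$A_0 = \begin{bmatrix} 2 & -3 & 2 & -3\\ -3 & 0 & 1 & 2\\ 2 & 1 & -2 & 1\\ -3 & 2 & 1 & -4 \end{bmatrix},\qquad B_0=\begin{bmatrix} 1&0&0&0\\0&2&0&0\\0&0&-2&0\\0&0&0&0\end{bmatrix}.$$ The smallest eigenvalue of $A_0\otimes B_0 + B_0\otimes A_0$ corresponds to a skew-symmetric eigenvector.
   Context: $\otimes$ is the Kronecker product. Let $T\in\mathbb{R}^{16\times 16}$ be the commutation matrix, i.e. $T\operatorname{vec}(X)=\operatorname{vec}(X^\top)$ for all $X\in\mathbb{R}^{4\times 4}$, where $\operatorname{vec}$ stacks columns. A vector $x\in\mathbb{R}^{16}$ is symmetric if $Tx=x$ and skew-symmetric if $Tx=-x$. For symmetric $A,B$, the symmetric matrix $A\otimes B+B\otimes A$ commutes with $T$ and has an orthonormal eigenbasis in which each eigenvector is either symmetric or skew-symmetric. *)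

(* Defs.v *)
From mathcomp Require Import all_boot all_order all_algebra.
From mathcomp Require Import mxtens reals.

Set Implicit Arguments.
Unset Strict Implicit.
Unset Printing Implicit Defensive.

Import Order.TTheory GRing.Theory Num.Theory.
Local Open Scope ring_scope.

Notation "A *t B" := (tensmx A B)
  (at level 40, left associativity, format "A  *t  B") : ring_scope.

(* Column stacking: X i j is the entry of index j * m + i. The same indexing
   (mxtens_index) underlies the Kronecker product tensmx, written *t; mxvec
   would stack rows instead. *)
Definition vec (R : Type) (m n : nat) (X : 'M[R]_(m, n)) : 'cV[R]_(n * m) :=
  \col_k X (mxtens_unindex k).2 (mxtens_unindex k).1.

Definition commutation_mx (R : pzRingType) (n : nat) : 'M[R]_(n * n) :=
  \matrix_(k, l) (((mxtens_unindex k).1 == (mxtens_unindex l).2) &&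
                   ((mxtens_unindex k).2 == (mxtens_unindex l).1))%:R.

(* This determines commutation_mx R n, since vec is onto. *)
Lemma mul_commutation_vec (R : pzRingType) (n : nat) (X : 'M[R]_n) :
  commutation_mx R n *m vec X = vec X^T.
Proof.
apply/colP => k; rewrite !mxE.
rewrite (bigD1 (mxtens_index ((mxtens_unindex k).2, (mxtens_unindex k).1))) //.
rewrite !mxE !mxtens_indexK !eqxx mul1r big1 ?addr0 => [|l /negP nl].
  by rewrite [LHS]addr0.
rewrite !mxE.
case: eqP => [e1|]; last by rewrite mul0r.
case: eqP => [e2|]; last by rewrite mul0r.
by case: nl; rewrite e1 e2 -surjective_pairing mxtens_unindexK.
Qed.

Definition skew_symmetric (R : pzRingType) (n : nat) (x : 'cV[R]_(n * n)) :=
  commutation_mx R n *m x = - x.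

(* Since M and M^T have the same eigenvalues, it does not matter that
   eigenvalue is defined by row eigenvectors. *)
Definition smallest_eigenvalue (R : realFieldType) (n : nat) (M : 'M[R]_n)
    (a : R) :=
  eigenvalue M a /\ (forall b : R, eigenvalue M b -> a <= b).

Definition eigenvector (R : fieldType) (n : nat) (M : 'M[R]_n) (a : R)
    (x : 'cV[R]_n) :=
  x != 0 /\ M *m x = a *: x.

Definition mx_of_rows (R : pzRingType) (m n : nat) (rows : seq (seq R)) :
    'M[R]_(m, n) :=
  \matrix_(i, j) nth 0 (nth [::] rows i) j.

Definition A0 (R : pzRingType) : 'M[R]_4 :=
  mx_of_rows 4 4
    [:: [::  2; -3;  2; -3];
        [:: -3;  0;  1;  2];
        [::  2;  1; -2;  1];
        [:: -3;  2;  1; -4]].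

Definition B0 (R : pzRingType) : 'M[R]_4 :=
  mx_of_rows 4 4
    [:: [:: 1; 0;  0; 0];
        [:: 0; 2;  0; 0];
        [:: 0; 0; -2; 0];
        [:: 0; 0;  0; 0]].

(* Main.v *)
(* The operator M sends vec X to vec (B X A + A X B), hence preserves symmetric
   and skew-symmetric matrices. On the hyperplane X 0 2 = X 2 0 the form M + 15
   is positive semidefinite (an explicit sum of squares), so M has at most one
   eigenvalue below -15: the span of two orthogonal eigenvectors would meet the
   hyperplane. On skew matrices, the characteristic polynomial changes sign
   between -16 and -15, and a column of the adjugate gives an eigenvector at the
   root. *)
Require Import Defs.
From mathcomp Require Import all_boot all_order all_algebra.
From mathcomp Require Import reals.
From mathcomp Require Import mxtens ring lra.

Import Order.TTheory GRing.Theory Num.Theory.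
Local Open Scope ring_scope.

Lemma mul_tensmx_vec (R : comPzRingType) (m n p q : nat) (A : 'M[R]_(m, n))
    (B : 'M[R]_(p, q)) (X : 'M[R]_(q, n)) :
  (A *t B) *m vec X = vec (B *m X *m A^T).
Proof.
apply/colP => k; rewrite !mxE.
under [RHS]eq_bigr => j _ do rewrite !mxE mulr_suml.
rewrite pair_big /= (reindex (@mxtens_unindex n q)) /=; last first.
  by exists (@mxtens_index n q) => i _; rewrite (mxtens_indexK, mxtens_unindexK).
by apply: eq_bigr => l _; rewrite !mxE -mulrA mulrC.
Qed.

Lemma vec_dot (R : comPzRingType) (m n : nat) (X Y : 'M[R]_(m, n)) :
  ((vec X)^T *m vec Y) 0 0 = \sum_i \sum_j X i j * Y i j.
Proof.
rewrite mxE exchange_big pair_big /= (reindex (@mxtens_unindex n m)) /=.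
  by apply: eq_bigr => l _; rewrite !mxE.
by exists (@mxtens_index n m) => i _; rewrite (mxtens_indexK, mxtens_unindexK).
Qed.

Lemma vec_surj (R : Type) (m n : nat) (v : 'cV[R]_(n * m)) :
  exists X : 'M[R]_(m, n), v = vec X.
Proof.
exists (\matrix_(i, j) v (mxtens_index (j, i)) 0).
by apply/colP => k; rewrite !mxE -surjective_pairing mxtens_unindexK.
Qed.

Lemma dot_gt0 (R : realFieldType) (n : nat) (v : 'rV[R]_n) :
  v != 0 -> 0 < (v *m v^T) 0 0.
Proof.
move=> v0; rewrite mxE lt_def sumr_ge0 ?andbT; last first.
  by move=> i _; rewrite mxE -expr2 sqr_ge0.
apply: contraNneq v0 => /eqP; rewrite psumr_eq0 => [/allP v0|i _]; last first.
  by rewrite mxE -expr2 sqr_ge0.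
apply/eqP/rowP => i; have := v0 i (mem_index_enum i).
by rewrite !mxE -expr2 sqrf_eq0 => /eqP.
Qed.

(** If [a] and [b] differ, the eigenvectors [x] and [y] are orthogonal. With [p = y l] and
    [q = x l], the vector [p x - q y] lies in the hyperplane, which forces [p^2 (c - a) |x|^2 + q^2
    (c - b) |y|^2 <= 0]. *)
Lemma eigenvalue_below_hyperplane (R : realFieldType) (n : nat) (M : 'M[R]_n)
    (l : 'cV[R]_n) (c a b : R) :
    M^T = M ->
    (forall z : 'rV[R]_n, z *m l = 0 ->
      c * (z *m z^T) 0 0 <= (z *m M *m z^T) 0 0) ->
    eigenvalue M a -> eigenvalue M b -> a < c -> b < c -> a = b.
Proof.
move=> symM posM /eigenvalueP[x xM x0] /eigenvalueP[y yM y0] ac bc.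
apply/eqP/negPn/negP => ab.
have xy : x *m y^T = 0.
  have : a *: (x *m y^T) = b *: (x *m y^T).
    by rewrite !scalemxAl -xM -mulmxA -{1}symM -trmx_mul yM linearZ -scalemxAr
      scalemxAl.
  by move/eqP; rewrite -subr_eq0 -scalerBl scaler_eq0 subr_eq0 (negPf ab) => /eqP.
have yx : y *m x^T = 0 by rewrite -[y]trmxK -trmx_mul xy trmx0.
have [xx yy] := (dot_gt0 _ _ _ x0, dot_gt0 _ _ _ y0).
pose p := (y *m l) 0 0; pose q := (x *m l) 0 0.
have lx : x *m l = q%:M by rewrite [LHS]mx11_scalar.
have ly : y *m l = p%:M by rewrite [LHS]mx11_scalar.
have zl : (p *: x - q *: y) *m l = 0.
  by rewrite mulmxBl -!scalemxAl lx ly !scale_scalar_mx mulrC subrr.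
have := posM _ zl.
rewrite !mulmxBl -!scalemxAl xM yM linearB /= !linearZ /= !mulmxDr.
rewrite -?scalemxAl -!scalemxAr !mulmxN xy yx oppr0 !scaler0 addr0 add0r.
move: (posM x); rewrite xM -!scalemxAl lx.
move: (x *m x^T) (y *m y^T) xx yy => u v u0 v0; rewrite !mxE => posx posz.
have ge0 : 0 <= p ^+ 2 * ((c - a) * u 0 0).
  by apply: mulr_ge0 (sqr_ge0 _) (mulr_ge0 _ (ltW u0)); rewrite subr_ge0 ltW.
(* Both terms are nonnegative, so [q = 0]. Then [x] itself is in the hyperplane, against [a < c];
   this also covers [p = q = 0]. *)
have q0 : q = 0.
  apply/eqP; rewrite -sqrf_eq0; apply: contraTT isT => q0.
  have : 0 < q ^+ 2 * ((c - b) * v 0 0).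
    by apply: mulr_gt0; rewrite ?lt_def ?q0 ?sqr_ge0 // -lt_def mulr_gt0 ?subr_gt0.
  lra.
have := posx; rewrite q0 raddf0 => /(_ erefl).
by rewrite ler_pM2r // leNgt ac.
Qed.

(** Indexing by [nat] makes entries such as [f 0%N 1%N] atoms for [ring] and [lra], free of ordinal
    proofs. *)
Definition nat_mx4 (R : Type) (f : nat -> nat -> R) : 'M[R]_4 :=
  \matrix_(i, j) f i j.

Lemma nat_mx4_surj (R : Type) (X : 'M[R]_4) : exists f, X = nat_mx4 R f.
Proof.
exists (fun i j => X (inord i) (inord j)).
by apply/matrixP => i j; rewrite !mxE !inord_val.
Qed.

Lemma mx_of_rows4 (R : pzRingType) (rows : seq (seq R)) :
  mx_of_rows 4 4 rows = nat_mx4 R (fun i j => nth 0 (nth [::] rows i) j).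
Proof. by []. Qed.

Lemma sum4 (R : nmodType) (f : nat -> R) :
  \sum_(i < 4) f i = f 0%N + f 1%N + f 2%N + f 3%N.
Proof. by rewrite !big_ord_recr big_ord0 /= add0r. Qed.

Lemma nat_mx4_mul (R : pzRingType) (f g : nat -> nat -> R) :
  nat_mx4 R f *m nat_mx4 R g = nat_mx4 R (fun i j =>
    f i 0%N * g 0%N j + f i 1%N * g 1%N j + f i 2%N * g 2%N j + f i 3%N * g 3%N j).
Proof.
apply/matrixP => i j; rewrite !mxE -(sum4 _ (fun k => f i k * g k j)).
by apply: eq_bigr => k _; rewrite !mxE.
Qed.

Lemma nat_mx4_add (R : pzRingType) (f g : nat -> nat -> R) :
  nat_mx4 R f + nat_mx4 R g = nat_mx4 R (fun i j => f i j + g i j).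
Proof. by apply/matrixP => i j; rewrite !mxE. Qed.

Lemma nat_mx4_dot (R : pzRingType) (f g : nat -> nat -> R) :
  let h i j := f i j * g i j in let r i := h i 0%N + h i 1%N + h i 2%N + h i 3%N in
  \sum_i \sum_j nat_mx4 R f i j * nat_mx4 R g i j = r 0%N + r 1%N + r 2%N + r 3%N.
Proof.
move=> h r; rewrite -(sum4 _ r); apply: eq_bigr => i _.
by rewrite /r -(sum4 _ (h i)); apply: eq_bigr => j _; rewrite !mxE.
Qed.

Local Notation M R := (A0 R *t B0 R + B0 R *t A0 R).

Lemma A0_sym (R : pzRingType) : (A0 R)^T = A0 R.
Proof.
by apply/matrixP => -[[|[|[|[|//]]]] ?] [[|[|[|[|//]]]] ?]; rewrite !mxE.
Qed.

Lemma B0_sym (R : pzRingType) : (B0 R)^T = B0 R.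
Proof.
by apply/matrixP => -[[|[|[|[|//]]]] ?] [[|[|[|[|//]]]] ?]; rewrite !mxE.
Qed.

(** The entries of [B0 X A0 + A0 X B0]: the diagonal [B0] scales the rows of [X A0] and the columns
    of [A0 X]. *)
Definition M_entries (R : pzRingType) (f : nat -> nat -> R) (i j : nat) : R :=
  let a i j := nth 0 (nth [::] [:: [:: 2; -3; 2; -3]; [:: -3; 0; 1; 2];
    [:: 2; 1; -2; 1]; [:: -3; 2; 1; -4]] i) j in
  let b i := nth 0 [:: 1; 2; -2; 0] i in
  b i * (f i 0%N * a 0%N j + f i 1%N * a 1%N j + f i 2%N * a 2%N j + f i 3%N * a 3%N j) +
  b j * (a i 0%N * f 0%N j + a i 1%N * f 1%N j + a i 2%N * f 2%N j + a i 3%N * f 3%N j).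

Lemma mul_M_vec (R : comPzRingType) (f : nat -> nat -> R) :
  M R *m vec (nat_mx4 R f) = vec (nat_mx4 R (M_entries R f)).
Proof.
rewrite mulmxDl !mul_tensmx_vec A0_sym B0_sym.
rewrite /A0 /B0 !mx_of_rows4 !nat_mx4_mul.
have -> (X Y : 'M[R]_4) : vec X + vec Y = vec (X + Y).
  by apply/colP => k; rewrite !mxE.
congr vec; rewrite nat_mx4_add; apply/matrixP => i j; rewrite !mxE /M_entries.
by case: i j => [[|[|[|[|//]]]] ?] [[|[|[|[|//]]]] ?] /=; ring.
Qed.

(** The symmetric and skew parts contribute separately. The hypothesis constrains only the skew
    part, removing its coordinate [d 0 2]. *)
Lemma M_ge_hyperplane (R : realFieldType) (f : nat -> nat -> R) :
  f 2%N 0%N = f 0%N 2%N ->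
  - 15 * ((vec (nat_mx4 R f))^T *m vec (nat_mx4 R f)) 0 0 <=
  ((vec (nat_mx4 R f))^T *m (M R *m vec (nat_mx4 R f))) 0 0.
Proof.
move=> f02; rewrite mul_M_vec !vec_dot !nat_mx4_dot /M_entries /=.
pose s i j := f i j + f j i; pose d i j := f i j - f j i.
(* Completing squares on the symmetric part s and the skew part d. The squares
   15, 2, 8 and 19, 20 are rounded; the five after them absorb the error. *)
move: (sqr_ge0 (s 3%N 3%N)).
move: (sqr_ge0 (19 * s 0%N 0%N - 6 * s 0%N 1%N + 4 * s 0%N 2%N - 6 * s 0%N 3%N)).
move: (sqr_ge0 (20 * s 0%N 1%N + 31 * s 0%N 2%N + 191 * s 0%N 3%N)).
move: (sqr_ge0 (- 12 * s 0%N 1%N + 15 * s 1%N 1%N + 4 * s 1%N 2%N + 8 * s 1%N 3%N)).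
move: (sqr_ge0 (- 42 * s 0%N 1%N + 14 * s 1%N 2%N + 73 * s 1%N 3%N)).
move: (sqr_ge0 (- 8 * s 0%N 2%N - 4 * s 1%N 2%N + 23 * s 2%N 2%N - 4 * s 2%N 3%N)).
move: (sqr_ge0 (122 * s 0%N 2%N - 100 * s 1%N 2%N + 521 * s 2%N 3%N)).
move: (sqr_ge0 (15 * s 0%N 1%N + 2 * s 0%N 2%N + 8 * s 1%N 2%N)).
move: (sqr_ge0 (19 * s 0%N 2%N + 20 * s 1%N 2%N)).
move: (sqr_ge0 (s 0%N 1%N - s 0%N 2%N)).
move: (sqr_ge0 (s 0%N 1%N + s 1%N 2%N)).
move: (sqr_ge0 (s 0%N 1%N)).
move: (sqr_ge0 (s 0%N 2%N)).
move: (sqr_ge0 (s 1%N 2%N)).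
move: (sqr_ge0 (2 * d 0%N 1%N + 11 * d 0%N 3%N)).
move: (sqr_ge0 (6 * d 0%N 1%N + 2 * d 1%N 2%N + 7 * d 1%N 3%N)).
move: (sqr_ge0 (4 * d 1%N 2%N + 23 * d 2%N 3%N)).
move: (sqr_ge0 (1039 * d 0%N 1%N - 440 * d 1%N 2%N)).
move: (sqr_ge0 (d 1%N 2%N)).
(* The goal is linear in the monomials [f i j * f k l], so [lra] only has to find weights for the
   squares. *)
by rewrite /s /d !f02; lra.
Qed.

(* The last column of the adjugate of M + 5 + r on skew matrices,
   in the basis E_ij - E_ji with i < j. The shift 5 keeps the literals,
   which are unary numerals, small. *)
Definition skew_cofactor (R : pzRingType) (r : R) (i j : nat) : R :=
  let x01 := - 22 * r ^+ 3 - 150 * r ^+ 2 + 14 * r - 114 in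
  let x02 := 6 * r ^+ 4 + 72 * r ^+ 3 - 260 * r ^+ 2 - 2776 * r - 1938 in
  let x03 := - 6 * r ^+ 3 - 22 * r ^+ 2 + 582 * r + 2166 in
  let x12 := - 4 * r ^+ 4 - 60 * r ^+ 3 + 4 * r ^+ 2 + 2180 * r + 1416 in
  let x13 := 8 * r ^+ 3 + 276 * r ^+ 2 + 1720 * r + 716 in
  let x23 := r ^+ 5 + 7 * r ^+ 4 - 120 * r ^+ 3 - 444 * r ^+ 2 + 2419 * r + 2081 in
  nth 0 (nth [::]
    [:: [:: 0; x01; x02; x03];
        [:: - x01; 0; x12; x13];
        [:: - x02; - x12; 0; x23];
        [:: - x03; - x13; - x23; 0]] i) j.

(* The determinant of M + 5 + r on skew matrices, expanded along its last
   column. *)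
Definition skew_det (R : pzRingType) (r : R) : R :=
  - 6 * skew_cofactor R r 0 2 + 4 * skew_cofactor R r 1 2
    + (13 + r) * skew_cofactor R r 2 3.

(** Applied to evaluation at [r], this lets [skew_det] at ['X] serve as the polynomial for the
    intermediate value theorem. *)
Lemma rmorph_skew_det (R S : comPzRingType) (f : {rmorphism R -> S}) (r : R) :
  f (skew_det R r) = skew_det S (f r).
Proof. by rewrite /skew_det /skew_cofactor /=; ring. Qed.

Lemma skew_det_root (R : rcfType) : exists2 r : R, 10 < r & skew_det R r = 0.
Proof.
have detE (r : R) : (skew_det {poly R} 'X).[r] = skew_det R r.
  by rewrite -[LHS]/(horner_eval r _) rmorph_skew_det /= horner_evalE hornerX.
have [||r /andP[r10 _] /rootP] := @poly_ivt R (skew_det _ 'X) 10 11; first by lra.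
  by rewrite !detE /skew_det /skew_cofactor /=; apply/andP; split; lra.
rewrite detE => pr; exists r => //; rewrite lt_def r10 andbT.
(* The determinant is negative at 10, so the root is not that endpoint. *)
by apply/eqP => r_eq; move: pr; rewrite r_eq /skew_det /skew_cofactor /=; lra.
Qed.

Lemma skew_eigenvector (R : rcfType) :
  exists2 a : R, a < - 15 & exists x : 'cV[R]_(4 * 4),
    eigenvector (M R) a x /\ skew_symmetric x.
Proof.
have [r r10 det0] := skew_det_root R.
exists (- 5 - r); first by lra.
exists (vec (nat_mx4 R (skew_cofactor R r))); split; first split.
- apply/eqP => /colP/(_ (mxtens_index (inord 3, inord 2))).
  rewrite !mxE mxtens_indexK /= !inordK // /skew_cofactor /= => x23.
  (* Expanded in [s = r - 10], the entry [x23] has only positive coefficients, hence is nonzero. *)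
  have [s [s0 rE]] : exists s, 0 < s /\ r = s + 10 by exists (r - 10); split; lra.
  have := (exprn_gt0 2 s0, exprn_gt0 3 s0, exprn_gt0 4 s0, exprn_gt0 5 s0).
  by case=> [[[s2 s3] s4] s5]; rewrite rE in x23; lra.
(* By the adjugate identity, only the entries (2,3) and (3,2) need [det0]; the others are identities
   in [r]. *)
- rewrite mul_M_vec; apply/colP => k; rewrite !mxE.
  move: (mxtens_unindex k) det0 => [j i]; rewrite /M_entries /skew_det /skew_cofactor /=.
  by case: i j => [[|[|[|[|//]]]] ?] [[|[|[|[|//]]]] ?] /=; lra.
- rewrite /skew_symmetric mul_commutation_vec; apply/colP => k; rewrite !mxE.
  move: (mxtens_unindex k) => [j i] /=; rewrite /skew_cofactor.
  by case: i j => [[|[|[|[|//]]]] ?] [[|[|[|[|//]]]] ?] /=; rewrite ?opprK ?oppr0.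
Qed.

Theorem proposition15 (R : realType) :
  exists a : R,
    smallest_eigenvalue (A0 R *t B0 R + B0 R *t A0 R) a /\
    exists x : 'cV[R]_(4 * 4),
      eigenvector (A0 R *t B0 R + B0 R *t A0 R) a x /\ skew_symmetric x.
Proof.
have symM : (M R)^T = M R by rewrite linearD /= !trmx_tens A0_sym B0_sym.
have [a a15 [x [[x0 xM] skx]]] := skew_eigenvector R.
exists a; split; last by exists x.
have eig_a : eigenvalue (M R) a.
  apply/eigenvalueP; exists x^T; last by rewrite trmx_eq0.
  by rewrite -{1}symM -trmx_mul xM linearZ.
split=> // b eig_b; rewrite leNgt; apply/negP => ba.
(* Pairing [vec X] with [l] gives [X 0 2 - X 2 0]. *)
pose l : 'cV[R]_(4 * 4) :=
  vec (nat_mx4 R (fun i j => ((i, j) == (0, 2)%N)%:R - ((i, j) == (2, 0)%N)%:R)).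
suff ab : b = a by rewrite ab ltxx in ba.
apply: (eigenvalue_below_hyperplane _ _ _ l (- 15) _ _ symM _ eig_b eig_a
          (lt_trans ba a15) a15) => z.
have [X zX] := vec_surj _ _ _ z^T; have [f Xf] := nat_mx4_surj _ X.
have -> : z = (vec (nat_mx4 R f))^T by rewrite -Xf -zX trmxK.
move=> /matrixP/(_ 0 0); rewrite vec_dot nat_mx4_dot /= mxE => f02.
by rewrite trmxK -mulmxA; apply: M_ge_hyperplane; lra.
Qed.
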